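(* Let $\Delta$ be a simplicial complex on $[n]$. The following conditions are equivalent: (i) $\Delta$ is a forest; (ii) $\Delta$ has no special cycle of length $\ge 3$; (iii) the incidence matrix of $\Delta$ has a canonical form which contains no submatrix of the form $$B=\begin{pmatrix}1&1\\1&0\end{pmatrix}.$$
   Context: A simplicial complex on $[n]=\{1,\ldots,n\}$ is a collection of subsets of $[n]$ (faces) closed under taking subsets; its maximal faces are its facets, and $\mathcal{F}(\Delta)$ is the set of facets. Complexes have at least one facet and their facets are nonempty. A subcomplex of $\Delta$ means a simplicial complex all of whose facets are facets of $\Delta$. A facet $F$ of $\Delta$ is a leaf if either $F$ is the only facet of $\Delta$, or there exists $G\in\mathcal{F}(\Delta)$, $G\ne F$, such that $H\cap F\subseteq G\cap F$ for each $H\in\mathcal{F}(\Delta)$ with $H\ne F$. $\Delta$ is a forest if each subcomplex of $\Delta$ has a leaf. An $s$-cycle (cycle of length $s$, $s\ge2$) of $\Delta$ is an alternating sequence $v_1,F_1,v_2,F_2,\ldots,v_s,F_s,v_{s+1}=v_1$ with $v_1,\ldots,v_s$ distinct vertices and $F_1,\ldots,F_s$ distinct facets of $\Delta$ such that $v_i,v_{i+1}\in F_i$ for $i=1,\ldots,s$. The cycle is special if none of its facets $F_1,\ldots,F_s$ contains more than two of the vertices $v_1,\ldots,v_s$. The incidence matrix of $\Delta$ with facets $F_1,\ldots,F_m$ is the $n\times m$ matrix $(e_{ij})$ with $e_{ij}=1$ if $i\in F_j$ and $e_{ij}=0$ otherwise (using the transpose instead makes no difference for condition (iii)). For integer vectors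 $\mathbf{a},\mathbf{b}$ of the same length, write $\mathbf{a}\prec\mathbf{b}$ if the right-most nonzero component of $\mathbf{a}-\mathbf{b}$ is negative, and $\mathbf{a}\preceq\mathbf{b}$ if $\mathbf{a}\prec\mathbf{b}$ or $\mathbf{a}=\mathbf{b}$. An integer matrix with rows $\mathbf{a}_1,\ldots,\mathbf{a}_p$ and columns $\mathbf{b}_1,\ldots,\mathbf{b}_q$ (columns read from top to bottom as vectors) is canonical if $\mathbf{a}_1\preceq\cdots\preceq\mathbf{a}_p$ and $\mathbf{b}_1\preceq\cdots\preceq\mathbf{b}_q$. A canonical form of a matrix is a canonical matrix obtained from it by permuting rows and columns. A submatrix is obtained by selecting (not necessarily consecutive) rows and columns, kept in their order. *)

(* Defs.v *)
From HB Require Import structures.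
From mathcomp Require Import all_boot all_order all_fingroup all_algebra.

Set Implicit Arguments.
Unset Strict Implicit.
Unset Printing Implicit Defensive.

Import Order.TTheory GRing.Theory Num.Theory.

Local Open Scope ring_scope.


(* [n] is 'I_n (0-based), and a complex is the set of all its faces; the
   singletons of [n] are not required to be faces. *)
Definition facets n (D : {set {set 'I_n}}) : {set {set 'I_n}} :=
  [set F | maxset (mem D) F].

Definition simplicial_complex n (D : {set {set 'I_n}}) : Prop :=
  [/\ forall A B : {set 'I_n}, A \subset B -> B \in D -> A \in D,
      facets D != set0
    & set0 \notin facets D].

Definition subcomplex n (D' D : {set {set 'I_n}}) : Prop :=
  simplicial_complex D' /\ facets D' \subset facets D.

Definition leaf n (D : {set {set 'I_n}}) (F : {set 'I_n}) : Prop :=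
  F \in facets D /\
  (facets D = [set F] \/
   exists G : {set 'I_n},
     [/\ G \in facets D, G != F
       & forall H : {set 'I_n}, H \in facets D -> H != F ->
           H :&: F \subset G :&: F]).

Definition forest n (D : {set {set 'I_n}}) : Prop :=
  forall D' : {set {set 'I_n}}, subcomplex D' D -> exists F, leaf D' F.

(* ordS is the cyclic successor on 'I_s, which encodes v_{s+1} = v_1. *)
Definition facet_cycle n (D : {set {set 'I_n}}) (s : nat)
    (v : 'I_s -> 'I_n) (F : 'I_s -> {set 'I_n}) : Prop :=
  [/\ (2 <= s)%N, injective v, injective F,
      forall i, F i \in facets D
    & forall i, (v i \in F i) && (v (ordS i) \in F i)].

Definition special n (s : nat)
    (v : 'I_s -> 'I_n) (F : 'I_s -> {set 'I_n}) : Prop :=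
  forall i, (#|[set v j | j : 'I_s] :&: F i| <= 2)%N.

Definition incidence_mx n m (F : m.-tuple {set 'I_n}) : 'M[int]_(n, m) :=
  \matrix_(i, j) (i \in tnth F j)%:R.

Definition vec_lt k (a b : 'rV[int]_k) : bool :=
  [exists i : 'I_k, ((a - b) 0 i < 0) &&
     [forall j : 'I_k, (i < j)%N ==> ((a - b) 0 j == 0)]].

Definition vec_le k (a b : 'rV[int]_k) : bool := vec_lt a b || (a == b).

Definition canonical_mx p q (A : 'M[int]_(p, q)) : bool :=
  sorted (@vec_le q) [seq row i A | i <- enum 'I_p] &&
  sorted (@vec_le p) [seq (col j A)^T | j <- enum 'I_q].

Definition canonical_form p q (A C : 'M[int]_(p, q)) : Prop :=
  canonical_mx C /\ exists (s : 'S_p) (t : 'S_q), C = row_perm s (col_perm t A).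

Definition submatrix k l p q (S : 'M[int]_(k, l)) (A : 'M[int]_(p, q)) : Prop :=
  exists (f : 'I_k -> 'I_p) (g : 'I_l -> 'I_q),
    [/\ {homo f : i j / (i < j)%N}, {homo g : i j / (i < j)%N}
      & mxsub f g A = S].

Definition B_mx : 'M[int]_(1 + 1) := block_mx 1 1
                                              1 0.

(* Main.v *)
Require Import Defs.
From mathcomp Require Import all_boot all_order all_fingroup all_algebra.
From mathcomp Require Import zify.

(** Call the matrix with rows (1 1) and (1 0) the forbidden submatrix.

    A forest has no special cycle of length at least 3: the facets of such a
    cycle generate a subcomplex, and the facet witnessing that one of them is a
    leaf would contain three vertices of the cycle
    ([forest_no_special_cycle]).

    If a canonical form avoids the forbidden submatrix, then in every
    subcomplex the traces of the other facets on the left-most facet are upper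
    sets for the order of the rows. They are therefore nested, and the
    left-most facet is a leaf ([gamma_free_forest]).

    It remains to find a canonical form without the forbidden submatrix when
    there is no special cycle. A canonical form exists because an arrangement
    maximizing the sum of the entries weighted by [2 ^ x * 2 ^ y] has its rows
    and its columns sorted by their values as binary numbers
    ([colex_sorted_arrangement]). Suppose that it contains the forbidden
    submatrix, in rows i0 < i1 and columns j0 < j1. Row i0 exceeds row i1 in
    column j1, so the last difference between the two rows is in a column j2
    further right, where row i1 has the 1; symmetrically there is a row i2
    below i1 that meets j1 but not j0. If i2 meets j2, the three rows and three
    columns form a chordless cycle. Otherwise the argument repeats with i1, i2
    and j1, j2: because rows i0, i1 agree to the right of j2 and columns j0, j1
    agree below i2, the new row and column meet only the ends of the induced
    path built so far ([chain_extend]). Rows and columns being finite in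
    number, the path eventually closes to a chordless cycle
    ([gamma_chordless_cycle]), which is a special cycle of the complex. *)

Set Implicit Arguments.
Unset Strict Implicit.
Unset Printing Implicit Defensive.

Import Order.TTheory GRing.Theory Num.Theory.

(** * Colexicographic comparison of Boolean vectors *)

(** The integer whose binary digits are the entries of [a]; comparing these
    integers is comparing the vectors from the right-most entry. *)
Definition binval p (a : 'I_p -> bool) : nat := \sum_(i < p) a i * 2 ^ i.

(** The relation [vec_le] on 0/1 vectors, in the form in which it is used: each
    place where [a] exceeds [b] is followed by a last difference, where [b]
    exceeds [a]. *)
Definition colex_le p (a b : 'I_p -> bool) : Prop :=
  forall i, a i -> ~~ b i ->
    exists j : 'I_p, [/\ i < j, ~~ a j, b j & forall l : 'I_p, j < l -> a l = b l].

(** The digit at [i] outweighs all lower ones, since the sum of the powers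
    [2 ^ l] over [l < i] is [2 ^ i - 1]. *)
Lemma binval_lt p (a b : 'I_p -> bool) (i : 'I_p) :
  ~~ a i -> b i -> (forall l : 'I_p, i < l -> a l = b l) -> binval a < binval b.
Proof.
move=> ai bi eq_ab; rewrite /binval.
rewrite (bigID (fun l : 'I_p => l <= i)) [ltnRHS](bigID (fun l : 'I_p => l <= i)) /=.
rewrite [X in _ + X < _](eq_bigr (fun l : 'I_p => b l * 2 ^ l)); last first.
  by move=> l; rewrite -ltnNge => /eq_ab ->.
rewrite ltn_add2r (bigD1 i) //= [ltnRHS](bigD1 i) //= (negbTE ai) bi mul0n add0n mul1n.
apply: leq_trans (leq_addr _ _).
apply: (@leq_ltn_trans (\sum_(l < p | l < i) 2 ^ l)).
  rewrite [leqRHS](eq_bigl (fun l : 'I_p => (l <= i) && (l != i))); last first.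
    by move=> l; rewrite ltn_neqAle andbC -val_eqE.
  by apply: leq_sum => l _; case: (a l); rewrite ?mul1n.
have -> : \sum_(l < p | l < i) 2 ^ l = \sum_(l < i) 2 ^ l.
  by rewrite (big_ord_widen p (fun l => 2 ^ l)) // ltnW.
elim: (nat_of_ord i) => [|k IH]; first by rewrite big_ord0.
by rewrite big_ord_recr /= expnS mul2n -addnn ltn_add2r.
Qed.

Lemma last_difference p (a b : 'I_p -> bool) (i : 'I_p) : a i != b i ->
  exists j : 'I_p, [/\ i <= j, a j != b j & forall l : 'I_p, j < l -> a l = b l].
Proof.
move=> ne_i; case: (@arg_maxnP _ i (fun l => a l != b l) val ne_i) => j ne_j max_j.
exists j; split=> //; first exact: max_j.
by move=> l lt_jl; apply/eqP; apply/negPn/negP => /max_j /=; rewrite leqNgt lt_jl.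
Qed.

Lemma binval_le_colex p (a b : 'I_p -> bool) :
  binval a <= binval b -> colex_le a b.
Proof.
move=> le_ab i ai bi.
have [|j [le_ij ne_j eq_j]] := @last_difference _ a b i.
  by rewrite ai (negbTE bi).
case aj: (a j) ne_j => bj; last first.
  exists j; rewrite aj; split=> //; last by case: (b j) bj.
  rewrite ltn_neqAle le_ij andbT; apply: contraTneq ai => /val_inj ->.
  by rewrite aj.
have {}bj : ~~ b j by case: (b j) bj.
have : binval b < binval a by apply: (binval_lt bj aj) => l /eq_j.
by rewrite ltnNge le_ab.
Qed.

(** * Existence of a canonical arrangement *)

(** The rearrangement inequality: exchanging two values that are out of order
    would strictly increase the sum, because the weights [2 ^ x] increase. *)
Lemma weighted_sum_max_homo p (w : 'I_p -> nat) :
  (forall u : 'S_p, \sum_(x < p) w (u x) * 2 ^ x <= \sum_(x < p) w x * 2 ^ x) ->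
  {homo w : x y / x < y >-> x <= y}.
Proof.
move=> wmax x y lt_xy; rewrite leqNgt; apply/negP => lt_w.
have := wmax (tperm x y); rewrite leqNgt => /negP; apply.
have ne_yx : y != x by rewrite -val_eqE /= gtn_eqF.
rewrite (bigD1 x) //= (bigD1 y) //= [ltnRHS](bigD1 x) //= [X in _ < _ + X](bigD1 y) //=.
rewrite tpermL tpermR [X in _ < _ + (_ + X)](eq_bigr (fun z => w z * 2 ^ z)); last first.
  by move=> z /andP[zx zy]; rewrite tpermD // eq_sym.
have : 2 ^ x < 2 ^ y by rewrite ltn_exp2l.
nia.
Qed.

(** Among all arrangements of the rows and columns of [A] take one that
    maximizes the sum of [A (s x) (t y) * 2 ^ x * 2 ^ y]. For fixed [t] this is
    the sum of the row values weighted by [2 ^ x], for fixed [s] the sum of the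
    column values weighted by [2 ^ y], so the rearrangement inequality sorts
    rows and columns simultaneously. *)
Lemma colex_sorted_arrangement p q (A : 'I_p -> 'I_q -> bool) :
  exists (s : 'S_p) (t : 'S_q), let C i j := A (s i) (t j) in
    (forall i i' : 'I_p, i < i' -> binval (C i) <= binval (C i')) /\
    (forall j j' : 'I_q, j < j' -> binval (C^~ j) <= binval (C^~ j')).
Proof.
pose Phi (st : 'S_p * 'S_q) :=
  \sum_(x < p) binval (fun y => A (st.1 x) (st.2 y)) * 2 ^ x.
case: (@arg_maxnP _ (1%g, 1%g) predT Phi isT) => -[s t] _ max_st.
exists s, t; split.
  apply: (@weighted_sum_max_homo _ (fun x => binval (fun y => A (s x) (t y)))) => u.
  have := max_st (u * s, t)%g isT; rewrite /Phi /= => le_u.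
  by under eq_bigr => x _ do rewrite -permM.
have PhiE s' t' : Phi (s', t') =
    \sum_(y < q) binval (fun x => A (s' x) (t' y)) * 2 ^ y.
  rewrite /Phi /binval.
  under eq_bigr => x _ do rewrite big_distrl /=.
  rewrite exchange_big; apply: eq_bigr => y _ /=.
  by rewrite big_distrl; apply: eq_bigr => x _ /=; rewrite mulnAC.
apply: (@weighted_sum_max_homo _ (fun y => binval (fun x => A (s x) (t y)))) => u.
have := max_st (s, u * t)%g isT; rewrite /= !PhiE => le_u.
by under eq_bigr => x _ do rewrite -permM.
Qed.

(** * From the forbidden submatrix to a chordless cycle *)

(** Incidences in the bipartite path
    ... i3 - j2 - i1 - j0 - i0 - j1 - i2 - j3 ...
    with rows [i a] and columns [j b]. *)
Definition path_adj (a b : nat) := [|| (a == 0) && (b == 0), a == b.+1 | b == a.+1].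

(** [k] rows and [k] columns forming an induced path in the bipartite graph of
    [C]. For [k = 2] this is the forbidden submatrix. The agreement conditions
    record that each new row (column) was obtained as the place of the last
    difference between two earlier columns (rows); they force a further row
    or column to meet nothing but an end of the path. *)
Record chain p q (C : 'I_p -> 'I_q -> bool) (k : nat)
    (i : nat -> 'I_p) (j : nat -> 'I_q) : Prop := Chain {
  chain_rows : forall a, a.+1 < k -> i a < i a.+1;
  chain_cols : forall a, a.+1 < k -> j a < j a.+1;
  chain_adj : forall a b, a < k -> b < k -> C (i a) (j b) = path_adj a b;
  chain_row_agree : forall a, a.+2 < k ->
    forall c : 'I_q, j a.+2 < c -> C (i a) c = C (i a.+1) c;
  chain_col_agree : forall a, a.+2 < k ->
    forall r : 'I_p, i a.+2 < r -> C r (j a) = C r (j a.+1) }.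

Lemma path_adjC a b : path_adj a b = path_adj b a.
Proof. by rewrite /path_adj andbC; congr (_ || _); rewrite orbC. Qed.

Lemma chain_tr p q (C : 'I_p -> 'I_q -> bool) k i j :
  chain C k i j -> chain (fun c r => C r c) k j i.
Proof. by case=> *; split=> // a b ak bk; rewrite path_adjC; auto. Qed.

(** Column [j k] exceeds column [j k.+1] in row [i k.+1], so their last
    difference lies in a lower row [r], which meets [j k.+1] but not [j k].
    Consecutive columns [j b] and [j b.+1] with [b < k] agree in row [r], hence
    [r] misses all the columns [j 0], ..., [j k]. *)
Lemma chain_next_row p q (C : 'I_p -> 'I_q -> bool) k i j :
  chain C k.+2 i j ->
  colex_le (C^~ (j k)) (C^~ (j k.+1)) ->
  exists r : 'I_p,
    [/\ i k.+1 < r,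
        forall b, b < k.+2 -> C r (j b) = (b == k.+1)
      & forall r' : 'I_p, r < r' -> C r' (j k) = C r' (j k.+1)].
Proof.
move=> ch dom.
have [||r [lt_ir rk rk1 agr]] := dom (i k.+1).
- by rewrite (chain_adj ch) // /path_adj; lia.
- by rewrite (chain_adj ch) // /path_adj; lia.
exists r; split=> //.
(* Descending induction on the column index, from [k] down to [0]. *)
have zeros d : d <= k -> C r (j (k - d)) = false.
  elim: d => [|d IH] ledk; first by rewrite subn0; apply: negbTE.
  have eq_d : (k - d.+1).+1 = k - d by lia.
  rewrite (chain_col_agree ch) ?eq_d ?IH //; try lia.
  apply: leq_ltn_trans lt_ir.
  have mono a b : a <= b -> b < k.+2 -> i a <= i b.
    elim: b => [|b IHb]; first by rewrite leqn0 => /eqP ->.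
    rewrite leq_eqVlt => /orP[/eqP -> //|]; rewrite ltnS => ab bk.
    by apply: leq_trans (IHb ab _) (ltnW (chain_rows ch bk)); lia.
  by apply: mono; lia.
move=> b lt_bk; have [->|ne_b] := eqVneq b k.+1; first exact: rk1.
have -> : b = k - (k - b) by lia.
by apply: zeros; lia.
Qed.

(** Both ends of the path are extended at once, by a row [r] and a column [c].
    All incidences are then known except the one between [r] and [c]: if it is
    0 the result is a longer chain, if it is 1 the path closes up. *)
Lemma chain_extend p q (C : 'I_p -> 'I_q -> bool) k i j :
  (forall r r' : 'I_p, r < r' -> colex_le (C r) (C r')) ->
  (forall c c' : 'I_q, c < c' -> colex_le (C^~ c) (C^~ c')) ->
  chain C k.+2 i j ->
  exists i' j',
    chain C k.+3 i' j' \/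
    [/\ forall a, a < k.+2 -> i' a < i' a.+1,
        forall a, a < k.+2 -> j' a < j' a.+1
      & forall a b, a < k.+3 -> b < k.+3 ->
          C (i' a) (j' b) = path_adj a b || (a == k.+2) && (b == k.+2)].
Proof.
move=> rdom cdom ch.
have [|r [lt_ir r_adj r_agr]] := chain_next_row ch.
  by apply: cdom; apply: (chain_cols ch).
have [|c [lt_jc c_adj c_agr]] := chain_next_row (chain_tr ch).
  by apply: rdom; apply: (chain_rows ch).
pose i' a := if a < k.+2 then i a else r.
pose j' a := if a < k.+2 then j a else c.
have iE a : a < k.+2 -> i' a = i a by rewrite /i' => ->.
have jE a : a < k.+2 -> j' a = j a by rewrite /j' => ->.
have iL : i' k.+2 = r by rewrite /i' ltnn.
have jL : j' k.+2 = c by rewrite /j' ltnn.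
have i_inc a : a < k.+2 -> i' a < i' a.+1.
  rewrite ltnS leq_eqVlt => /orP[/eqP->|lt_a]; first by rewrite iL iE.
  by rewrite !iE //; [apply: (chain_rows ch) | lia].
have j_inc a : a < k.+2 -> j' a < j' a.+1.
  rewrite ltnS leq_eqVlt => /orP[/eqP->|lt_a]; first by rewrite jL jE.
  by rewrite !jE //; [apply: (chain_cols ch) | lia].
have adj a b : a < k.+3 -> b < k.+3 -> C (i' a) (j' b) =
    if (a == k.+2) && (b == k.+2) then C r c else path_adj a b.
  move=> lt_a lt_b.
  have [ea|ne_a] := eqVneq a k.+2; have [eb|ne_b] := eqVneq b k.+2 => /=.
  - by rewrite ea eb iL jL.
  - rewrite ea iL jE; last by lia.
    by rewrite r_adj /path_adj; lia.
  - rewrite eb jL iE; last by lia.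
    by rewrite c_adj /path_adj; lia.
  rewrite iE ?jE; try lia.
  by apply: (chain_adj ch); lia.
exists i', j'; case Crc: (C r c) in adj.
  right; split=> // a b lt_a lt_b; rewrite adj //.
  by case: ifP => /=; rewrite ?orbT ?orbF.
left; split=> //.
- move=> a b lt_a lt_b; rewrite adj //; case: ifP => //; rewrite /path_adj; lia.
- move=> a; rewrite !ltnS leq_eqVlt => /orP[/eqP->|lt_a] c'.
    by rewrite jL !iE; try lia; apply: c_agr.
  by rewrite jE ?iE //; try lia; apply: (chain_row_agree ch).
- move=> a; rewrite !ltnS leq_eqVlt => /orP[/eqP->|lt_a] r'.
    by rewrite iL !jE; try lia; apply: r_agr.
  by rewrite iE ?jE //; try lia; apply: (chain_col_agree ch).
Qed.

(** The closed path on [k] rows and [k] columns, traversed from end to end,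
    visits the rows [k - 1, k - 3, ...] down to 0 or 1 and then those of the
    other parity upwards; [zigzag_row k t] is the row visited at time [t] and
    [zigzag_col k t] the column visited right after it. *)
Definition zigzag_row k t := if 2 * t < k then k - 1 - 2 * t else 2 * t - k.
Definition zigzag_col k t := if 2 * t + 2 <= k then k - 2 - 2 * t else 2 * t + 1 - k.

Definition chordless_cycle p q (C : 'I_p -> 'I_q -> bool) k
    (v : 'I_k -> 'I_p) (g : 'I_k -> 'I_q) : Prop :=
  [/\ injective v, injective g
    & forall a b, C (v a) (g b) = (a == b) || (a == ordS b)].

Lemma zigzag_cycle p q (C : 'I_p -> 'I_q -> bool) k (i : nat -> 'I_p) (j : nat -> 'I_q) :
  2 < k ->
  (forall a, a.+1 < k -> i a < i a.+1) ->
  (forall a, a.+1 < k -> j a < j a.+1) ->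
  (forall a b, a < k -> b < k ->
     C (i a) (j b) = path_adj a b || (a == k.-1) && (b == k.-1)) ->
  chordless_cycle C (fun t : 'I_k => i (zigzag_row k t))
                    (fun t : 'I_k => j (zigzag_col k t)).
Proof.
move=> k_gt2 i_inc j_inc adj.
have inj_inc m (f : nat -> 'I_m) a b : (forall c, c.+1 < k -> f c < f c.+1) ->
    a < k -> b < k -> f a = f b -> a = b.
  move=> inc.
  have mono x y : x < y -> y < k -> f x < f y.
    elim: y => [//|y IH]; rewrite ltnS leq_eqVlt => /orP[/eqP ->|xy] yk.
      exact: inc.
    by apply: ltn_trans (IH xy _) (inc _ yk); lia.
  move=> ak bk; case: (ltngtP a b) => // [/mono/(_ bk)|/mono/(_ ak)].
    by move=> + E; rewrite E ltnn.
  by move=> + E; rewrite E ltnn.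
have row_lt (t : 'I_k) : zigzag_row k t < k.
  by rewrite /zigzag_row; have := ltn_ord t; case: ifP; lia.
have col_lt (t : 'I_k) : zigzag_col k t < k.
  by rewrite /zigzag_col; have := ltn_ord t; case: ifP; lia.
split.
- move=> a b /(inj_inc _ _ _ _ i_inc (row_lt a) (row_lt b)) E; apply: val_inj => /=.
  by move: E; rewrite /zigzag_row; have := ltn_ord a; have := ltn_ord b; do 2!case: ifP; lia.
- move=> a b /(inj_inc _ _ _ _ j_inc (col_lt a) (col_lt b)) E; apply: val_inj => /=.
  by move: E; rewrite /zigzag_col; have := ltn_ord a; have := ltn_ord b; do 2!case: ifP; lia.
move=> a b; rewrite adj // -!val_eqE /=.
(* Without [%%] the goal is linear arithmetic in each case. *)
have -> : b.+1 %% k = if b.+1 == k then 0 else b.+1.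
  case: eqP => [->|ne]; first by rewrite modnn.
  by rewrite modn_small //; have := ltn_ord b; lia.
have := ltn_ord a; have := ltn_ord b; rewrite /path_adj /zigzag_row /zigzag_col.
by do 3!case: ifP; lia.
Qed.

(** The forbidden submatrix is a chain of length 2. It can be extended until it
    closes up, and it must close up, because the rows of a chain are strictly
    increasing and there are only [p] of them. *)
Lemma gamma_chordless_cycle p q (C : 'I_p -> 'I_q -> bool) (r r' : 'I_p) (c c' : 'I_q) :
  (forall r r' : 'I_p, r < r' -> colex_le (C r) (C r')) ->
  (forall c c' : 'I_q, c < c' -> colex_le (C^~ c) (C^~ c')) ->
  r < r' -> c < c' -> C r c -> C r c' -> C r' c -> ~~ C r' c' ->
  exists k (v : 'I_k -> 'I_p) (g : 'I_k -> 'I_q), 2 < k /\ chordless_cycle C v g.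
Proof.
move=> rdom cdom lt_r lt_c rc rc' r'c r'c'.
have grow k : (exists k' (v : 'I_k' -> 'I_p) (g : 'I_k' -> 'I_q),
      2 < k' /\ chordless_cycle C v g) \/
    (exists i j, chain C k.+2 i j).
  elim: k => [|k [IH|[i [j ch]]]]; [|by left|].
    right; exists (fun a => if a == 0 then r else r'), (fun a => if a == 0 then c else c').
    split=> //; try by case.
    by move=> [|[|a]] [|[|b]] // _ _ /=; rewrite ?rc ?rc' ?r'c // (negbTE r'c').
  have [i' [j' [ch'|[i_inc j_inc adj]]]] := chain_extend rdom cdom ch.
    by right; exists i', j'.
  left; exists k.+3; eexists; eexists; split; first by [].
  exact: (@zigzag_cycle _ _ C k.+3 i' j').
case: (grow p) => [//|[i [j ch]]]; exfalso.
have lei a : a < p.+2 -> a <= i a.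
  elim: a => [//|a IH] lt_a.
  by apply: leq_ltn_trans (IH _) (chain_rows ch lt_a); lia.
by have := lei p (leqnSn _); rewrite leqNgt ltn_ord.
Qed.

Local Open Scope ring_scope.

(** * Canonical integer matrices *)

Lemma submatrix_BP p q (C : 'M[int]_(p, q)) :
  submatrix B_mx C <->
  exists (i i' : 'I_p) (j j' : 'I_q), [/\ (i < i')%N, (j < j')%N &
    [/\ C i j = 1, C i j' = 1, C i' j = 1 & C i' j' = 0]].
Proof.
pose l : 'I_(1 + 1) := lshift 1 ord0; pose h : 'I_(1 + 1) := rshift 1 ord0.
have Bll : B_mx l l = 1 by rewrite /B_mx block_mxEul mxE.
have Blh : B_mx l h = 1 by rewrite /B_mx block_mxEur mxE.
have Bhl : B_mx h l = 1 by rewrite /B_mx block_mxEdl mxE.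
have Bhh : B_mx h h = 0 by rewrite /B_mx block_mxEdr mxE.
split=> [[f [g [fh gh E]]]|[i [i' [j [j' [lti ltj [E1 E2 E3 E4]]]]]]].
  have EC a b : C (f a) (g b) = B_mx a b by rewrite -E mxE.
  exists (f l), (f h), (g l), (g h); split; [exact: fh|exact: gh|].
  by rewrite !EC.
have lhP (a : 'I_(1 + 1)) : a = l \/ a = h.
  by case: a => [[|[|//]] ?]; [left|right]; apply: val_inj.
exists (fun a => if a == l then i else i'), (fun a => if a == l then j else j'); split.
- by move=> a b; case: (lhP a) => ->; case: (lhP b) => ->.
- by move=> a b; case: (lhP a) => ->; case: (lhP b) => ->.
apply/matrixP => a b; rewrite mxE.
by case: (lhP a) => ->; case: (lhP b) => ->; rewrite ?(Bll, Blh, Bhl, Bhh).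
Qed.

Lemma colex_vec_le p (a b : 'I_p -> bool) :
  colex_le a b -> vec_le (\row_i (a i)%:R) (\row_i (b i)%:R).
Proof.
move=> dom; rewrite /vec_le.
have [eq_ab|/existsP[i0 ne_i0]] := altP (@forallP _ (fun i => a i == b i)).
  by apply/orP; right; apply/eqP/rowP => i; rewrite !mxE (eqP (eq_ab i)).
apply/orP; left; apply/existsP.
(* The last difference [j] has the right sign: if [a j] exceeded [b j], then
   [colex_le a b] would give a difference after [j]. *)
have [i [ai bi agr]] : exists i : 'I_p, [/\ ~~ a i, b i
    & forall l : 'I_p, (i < l)%N -> a l = b l].
  have [j [_ ne_j agr]] := last_difference ne_i0.
  case aj: (a j) ne_j => bj; last first.
    by exists j; rewrite aj; split=> //; case: (b j) bj.
  have [|l [_ al bl agr']] := dom j aj; first by case: (b j) bj.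
  by exists l.
exists i; rewrite !mxE (negbTE ai) bi; apply/andP; split=> //.
by apply/forallP => l; apply/implyP => /agr E; rewrite !mxE E subrr.
Qed.

Lemma sorted_enum_ord k T (le : rel T) (f : 'I_k -> T) :
  (forall x y : 'I_k, (x < y)%N -> le (f x) (f y)) ->
  sorted le [seq f x | x <- enum 'I_k].
Proof.
move=> le_f; rewrite sorted_map.
apply: (@sub_sorted _ (relpre val ltn)) => [x y /le_f //|].
by rewrite -sorted_map val_enum_ord iota_ltn_sorted.
Qed.

Lemma colex_sorted_canonical p q (C : 'M[int]_(p, q)) (c : 'I_p -> 'I_q -> bool) :
  (forall i j, C i j = (c i j)%:R) ->
  (forall i i' : 'I_p, (i < i')%N -> colex_le (c i) (c i')) ->
  (forall j j' : 'I_q, (j < j')%N -> colex_le (c^~ j) (c^~ j')) ->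
  canonical_mx C.
Proof.
move=> CE rdom cdom; apply/andP; split; apply: sorted_enum_ord => x y lt_xy.
  have rE z : row z C = \row_j (c z j)%:R by apply/rowP => j; rewrite !mxE CE.
  by rewrite !rE; apply: colex_vec_le; apply: rdom.
have cE z : (col z C)^T = \row_i (c i z)%:R by apply/rowP => j; rewrite !mxE CE.
by rewrite !cE; apply: colex_vec_le; apply: cdom.
Qed.

(** * Forests have no special cycle *)

(** The facets of a complex form an antichain, so any nonempty set of them is
    exactly the set of facets of the complex that it generates. *)
Lemma facets_generated n (D S : {set {set 'I_n}}) :
  simplicial_complex D -> S != set0 -> S \subset facets D ->
  let D' := [set A : {set 'I_n} | [exists F in S, A \subset F]] in
  facets D' = S /\ subcomplex D' D.
Proof.
move=> [_ _ D0] S0 sSD D'.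
have memD' (A : {set 'I_n}) : A \in S -> A \in D'.
  by move=> AS; rewrite inE; apply/existsP; exists A; rewrite AS subxx.
have fE : facets D' = S.
  apply/setP => A; rewrite inE; apply/idP/idP.
    case/maxsetP => AD'; move: (AD' : A \in D'); rewrite inE => /existsP[F /andP[FS sAF]] maxA.
    by rewrite -(maxA F (memD' _ FS) sAF).
  move=> AS; apply/maxsetP; split=> [|B]; first exact: memD'.
  move=> BD'; move: (BD' : B \in D'); rewrite inE => /existsP[F /andP[FS sBF]] sAB.
  have := subsetP sSD _ AS; rewrite inE => /maxsetP[_ maxA].
  have := subsetP sSD _ FS; rewrite inE => /maxsetP[FD _].
  apply/eqP; rewrite eqEsubset sAB andbT.
  by rewrite -(maxA F FD (subset_trans sAB sBF)).
split=> //; split; last by rewrite fE.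
split; rewrite ?fE //; last by apply: contra D0; apply: (subsetP sSD).
move=> A B sAB; rewrite !inE => /existsP[F /andP[FS sBF]].
by apply/existsP; exists F; rewrite FS (subset_trans sAB).
Qed.

Lemma ordS_neq s (i : 'I_s) : (2 <= s)%N -> ordS i != i.
Proof.
move=> s2; rewrite -val_eqE /=.
have := ltn_ord i; case: (eqVneq i.+1 s) => [E|ne] lt_i.
  by rewrite E modnn; lia.
by rewrite modn_small; lia.
Qed.

Lemma ordSS_neq s (i : 'I_s) : (3 <= s)%N -> ordS (ordS i) != i.
Proof.
move=> s3; rewrite -val_eqE /=; have lt_i := ltn_ord i.
case: (eqVneq i.+1 s) => [E|ne].
  by rewrite E modnn modn_small; lia.
rewrite (@modn_small i.+1); last by lia.
case: (eqVneq i.+2 s) => [E|ne']; first by rewrite E modnn; lia.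
by rewrite modn_small; lia.
Qed.

(** In the subcomplex generated by the facets of a special cycle let [G i] be a
    leaf. Its two neighbours on the cycle share [v i] and [v (ordS i)] with it, so
    the facet [G j] that witnesses the leaf contains both. It also contains
    [v j] and [v (ordS j)], one of which is a third vertex since [j != i] and
    the length is at least 3. *)
Lemma forest_no_special_cycle n (D : {set {set 'I_n}}) :
  simplicial_complex D -> forest D ->
  ~ (exists (s : nat) (v : 'I_s -> 'I_n) (G : 'I_s -> {set 'I_n}),
       [/\ (3 <= s)%N, facet_cycle D v G & special v G]).
Proof.
move=> hD fD [s [v [G [s3 [_ v_inj G_inj GD vG] sp]]]].
have s_gt0 : (0 < s)%N by lia.
pose S := [set G t | t : 'I_s].
have S0 : S != set0.
  by apply/set0Pn; exists (G (Ordinal s_gt0)); apply: imset_f.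
have sSD : S \subset facets D by apply/subsetP => _ /imsetP[t _ ->].
have [fE sub] := facets_generated hD S0 sSD.
have [Fl []] := fD _ sub; rewrite fE => /imsetP[i _ ->] {Fl} [S1|].
  have : G (ordS i) \in S by apply: imset_f.
  rewrite S1 inE => /eqP/G_inj/eqP.
  by rewrite (negbTE (ordS_neq _ _)) //; lia.
case=> G' [/imsetP[j _ ->] ne_ji sH].
have {ne_ji} ne_ji : j != i by apply: contra ne_ji => /eqP->.
have vi_Gj : v i \in G j.
  have := sH (G (ord_pred i)); rewrite imset_f // => /(_ isT) sP.
  have ne : G (ord_pred i) != G i.
    apply/eqP => /G_inj E; have := ordS_neq (ord_pred i) (ltnW s3).
    by rewrite ord_predK E eqxx.
  have /subsetP/(_ (v i)) := sP ne; rewrite !inE.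
  have := vG (ord_pred i); rewrite ord_predK => /andP[_ ->].
  by have /andP[-> _] := vG i => /(_ isT)/andP[].
have vSi_Gj : v (ordS i) \in G j.
  have := sH (G (ordS i)); rewrite imset_f // => /(_ isT) sP.
  have ne : G (ordS i) != G i.
    by apply/eqP => /G_inj/eqP; rewrite (negbTE (ordS_neq _ (ltnW s3))).
  have /subsetP/(_ (v (ordS i))) := sP ne; rewrite !inE.
  have /andP[-> _] := vG (ordS i).
  by have /andP[_ ->] := vG i => /(_ isT)/andP[].
have /andP[vj_Gj vSj_Gj] := vG j.
have [x [x_i x_Si x_Gj]] : exists x, [/\ x != i, x != ordS i & v x \in G j].
  have [ejS|ne_jS] := eqVneq j (ordS i); last by exists j.
  exists (ordS j); split=> //; rewrite ejS ?ordSS_neq //.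
  by rewrite ordS_neq // ltnW.
have := sp j; rewrite leqNgt => /negP; apply.
have sub3 : [set v x; v i; v (ordS i)] \subset [set v t | t : 'I_s] :&: G j.
  by apply/subsetP => y; rewrite !inE => /orP[/orP[]|] /eqP->; rewrite imset_f.
apply: leq_trans (subset_leq_card sub3).
rewrite -setUA !cardsU1 cards1 !inE !(inj_eq v_inj).
by rewrite (negbTE x_i) (negbTE x_Si) eq_sym (negbTE (ordS_neq _ (ltnW s3))).
Qed.

(** * The left-most facet is a leaf *)

(** By hypothesis the sets [H :&: F] with [H] in [S] are upper sets of [F] for
    the order given by [r]. Upper sets of a chain are nested, so a largest
    [G :&: F] contains all the others. *)
Lemma gamma_free_leaf (V : finType) k (r : V -> 'I_k) (S : {set {set V}}) (F : {set V}) :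
  injective r ->
  F \in S ->
  (forall H x y, H \in S -> x \in F -> y \in F -> (r x < r y)%N -> x \in H -> y \in H) ->
  S = [set F] \/
  exists G, [/\ G \in S, G != F
    & forall H, H \in S -> H != F -> H :&: F \subset G :&: F].
Proof.
move=> r_inj FS up.
have [S0|[G0 G0P]] := set_0Vmem (S :\ F).
  left; apply/eqP; rewrite eqEsubset sub1set FS andbT.
  apply/subsetP => H HS; rewrite inE; apply: contraT => HF.
  by have := in_set0 H; rewrite -S0 !inE HF HS.
right; case: (@arg_maxnP _ G0 (mem (S :\ F)) (fun H => #|H :&: F|) G0P) => G.
rewrite !inE => /andP[GF GS] maxG.
exists G; split=> // H HS HF; apply/subsetP => x; rewrite !inE => /andP[xH xF].
rewrite xF andbT; apply: contraT => xG.
have : G :&: F \proper H :&: F.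
  apply/properP; split; last by exists x; rewrite !inE ?xH ?xF ?(negbTE xG).
  apply/subsetP => y; rewrite !inE => /andP[yG yF]; rewrite yF andbT.
  case: (ltngtP (r x) (r y)) => [lt_xy|lt_yx|/val_inj/r_inj <- //].
    exact: (up H x y).
  by move: xG; rewrite (up G y x).
move/proper_card; rewrite ltnNge => /negP; case.
by apply: maxG; rewrite !inE HF.
Qed.

(** Given a subcomplex, let [F] be its facet with the left-most column. If
    another facet [H] contained a vertex [x] of [F] but not a vertex [y] of [F]
    in a lower row, rows [x], [y] and columns [F], [H] would form the forbidden
    submatrix. *)
Lemma gamma_free_forest n (D : {set {set 'I_n}}) m (F : m.-tuple {set 'I_n})
    (C : 'M[int]_(n, m)) :
  F =i facets D -> canonical_form (incidence_mx F) C -> ~ submatrix B_mx C ->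
  forest D.
Proof.
move=> FD [_ [s [t CE]]] /submatrix_BP noB D' [[_ D'0 _] sD'].
have CE' i j : C i j = (s i \in tnth F (t j))%:R by rewrite CE !mxE.
have col_of H : H \in facets D' -> exists j, H = tnth F (t j).
  move=> /(subsetP sD'); rewrite -FD => /tnthP[j ->].
  by exists ((t^-1)%g j); rewrite permKV.
have [H0 H0D'] := set0Pn _ D'0; have [j0 H0E] := col_of _ H0D'.
have P0 : tnth F (t j0) \in facets D' by rewrite -H0E.
case: (@arg_minnP _ j0 (fun j => tnth F (t j) \in facets D') val P0) => j jD' min_j.
exists (tnth F (t j)); split=> //.
apply: (gamma_free_leaf (r := (s^-1)%g)) => //; first exact: perm_inj.
move=> H x y HD' xF yF lt_xy xH; apply: contraT => yH.
have [l HE] := col_of _ HD'; rewrite HE in HD' xH yH.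
have lt_jl : (j < l)%N.
  rewrite ltn_neqAle (min_j l HD') andbT val_eqE.
  by apply: contraNneq yH => <-.
case: noB; exists ((s^-1)%g x), ((s^-1)%g y), j, l; split=> //.
by rewrite !CE' !permKV xF yF xH (negbTE yH).
Qed.

(** * The equivalence *)

(** A chordless cycle of the incidence matrix is a special cycle of the complex:
    each facet on it contains just two of its vertices. *)
Lemma no_special_cycle_gamma_free n (D : {set {set 'I_n}}) m (F : m.-tuple {set 'I_n}) :
  uniq F -> F =i facets D ->
  ~ (exists (s : nat) (v : 'I_s -> 'I_n) (G : 'I_s -> {set 'I_n}),
       [/\ (3 <= s)%N, facet_cycle D v G & special v G]) ->
  exists C : 'M[int]_(n, m),
    canonical_form (incidence_mx F) C /\ ~ submatrix B_mx C.
Proof.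
move=> F_uniq FD no_cycle.
have [s [t [rle cle]]] := colex_sorted_arrangement (fun i j => i \in tnth F j).
pose c i j := s i \in tnth F (t j).
have rdom (i i' : 'I_n) : (i < i')%N -> colex_le (c i) (c i').
  by move=> /rle; apply: binval_le_colex.
have cdom (j j' : 'I_m) : (j < j')%N -> colex_le (c^~ j) (c^~ j').
  by move=> /cle; apply: binval_le_colex.
pose C := row_perm s (col_perm t (incidence_mx F)).
have CE i j : C i j = (c i j)%:R by rewrite !mxE.
exists C; split.
  by split; [exact: colex_sorted_canonical CE rdom cdom | exists s, t].
move=> /submatrix_BP[i [i' [j [j' [lti ltj]]]]]; rewrite !CE => -[E1 E2 E3 E4].
have b1 (b : bool) : b%:R = 1 :> int -> b by case: b.
have b0 (b : bool) : b%:R = 0 :> int -> ~~ b by case: b.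
have [k [v [g [k3 [v_inj g_inj adj]]]]] :=
  gamma_chordless_cycle rdom cdom lti ltj (b1 _ E1) (b1 _ E2) (b1 _ E3) (b0 _ E4).
apply: no_cycle; exists k, (fun a => s (v a)), (fun a => tnth F (t (g a))).
have adj' a b : (s (v a) \in tnth F (t (g b))) = (a == b) || (a == ordS b) := adj a b.
split=> //.
  split=> [||||a]; first by rewrite ltnW.
  - by move=> a b /perm_inj/v_inj.
  - by move=> a b /(tuple_uniqP _ F_uniq)/perm_inj/g_inj.
  - by move=> a; rewrite -FD mem_tnth.
  - by rewrite !adj' !eqxx orbT.
move=> b; apply: (@leq_trans #|[set s (v b); s (v (ordS b))]|).
  apply/subset_leq_card/subsetP => x; rewrite inE => /andP[/imsetP[a _ ->]].
  by rewrite adj' !inE => /orP[] /eqP->; rewrite eqxx ?orbT.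
by rewrite cards2; case: eqP.
Qed.

Theorem theorem3p2 (n : nat) (D : {set {set 'I_n}}) (hD : simplicial_complex D)
    (m : nat) (F : m.-tuple {set 'I_n}) (F_uniq : uniq F) (F_facets : F =i facets D) :
  [<-> forest D;
       ~ (exists (s : nat) (v : 'I_s -> 'I_n) (G : 'I_s -> {set 'I_n}),
            [/\ (3 <= s)%N, facet_cycle D v G & special v G]);
       exists C : 'M[int]_(n, m),
         canonical_form (incidence_mx F) C /\ ~ submatrix B_mx C].
Proof.
tfae.
- exact: forest_no_special_cycle.
- exact: no_special_cycle_gamma_free.
- by case=> C [canC noB]; exact: gamma_free_forest canC noB.
Qed.
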